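(* Let $H$ be an infinite cyclic group. Then the distortion functions of embeddings of $H$ into finitely generated groups $G$ are, up to the equivalence $\approx$, exactly all the increasing superadditive functions $f:\mathbb{N}\to\mathbb{N}$. That is, for every embedding of $H$ into a finitely generated group $G$ there is an increasing superadditive $f:\mathbb{N}\to\mathbb{N}$ with $\Delta_H^G\approx f$, and for every increasing superadditive $f:\mathbb{N}\to\mathbb{N}$ there is an embedding of $H$ into a finitely generated group $G$ with $\Delta_H^G\approx f$. The same holds with ''finitely generated groups $G$'' replaced by ''finitely generated solvable groups $G$''.
   Context: $\mathbb{N}=\{1,2,\dots\}$. A function $f:\mathbb{N}\to\mathbb{N}$ is superadditive if $f(r+s)\ge f(r)+f(s)$ for all $r,s$. For a group $G$ with finite generating set $X$, $|g|_X$ denotes word length. If $H$ is a subgroup of $G$ (or is embedded in $G$), with $H$ and $G$ generated by finite sets $Y$ and $X$ respectively, the distortion function is $\Delta_H^G(r)=\max\{|h|_Y: h\in H,\ |h|_X\le r\}$, $r\in\mathbb{N}$. For functions $f,g$ on $\mathbb{N}$ with nonnegative values, $f\preceq g$ means there is a positive integer $c$ with $f(r)\le c\,g(cr)$ for all $r\in\mathbb{N}$; $f\approx g$ means $f\preceq g$ and $g\preceq f$. Up to $\approx$, $\Delta_H^G$ does not depend on the choice of $X,Y$. *)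

(* Defs.v *)
(* MathComp, with the classical sets of MathComp-Analysis. Groups, possibly
   infinite, are the groupType structures of mathcomp.boot.monoid. *)
From HB Require Import structures.
From mathcomp Require Import all_boot all_order.
From mathcomp Require Import boolp classical_sets functions cardinality.

Set Implicit Arguments.
Unset Strict Implicit.
Unset Printing Implicit Defensive.

Import Order.TTheory.
Local Open Scope classical_set_scope.
Local Open Scope group_scope.

(* Functions on N = {1, 2, ...} are encoded as functions on nat whose value at 0
   is ignored by every definition below. *)
Definition maps_to_N (f : nat -> nat) := forall r, 0 < r -> 0 < f r.

Definition increasing (f : nat -> nat) :=
  forall r s, 0 < r -> r < s -> f r < f s.

Definition superadditive (f : nat -> nat) :=
  forall r s, 0 < r -> 0 < s -> (f r + f s <= f (r + s))%N.

Definition preceq (f g : nat -> nat) :=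
  exists2 c, 0 < c & forall r, 0 < r -> (f r <= c * g (c * r))%N.

Definition approx (f g : nat -> nat) := preceq f g /\ preceq g f.

(* Both default to 0 when the minimum, resp. maximum, does not exist; see
   word_lengthP and distortionP. *)
Definition set_min (A : set nat) : nat := xget 0%N (A `&` lbound A).
Definition set_max (A : set nat) : nat := xget 0%N (A `&` ubound A).

Section GroupNotions.
Variable G : groupType.
Implicit Types (X : set G) (g : G) (w : seq G).

Definition is_word X w := forall x, x \in w -> X x \/ X x^-1.

Definition generated X : set G :=
  [set g | exists2 w, is_word X w & \prod_(x <- w) x = g].

Definition generates X := generated X = [set: G].

Definition word_length X g : nat :=
  set_min [set n | exists w, [/\ is_word X w, \prod_(x <- w) x = g & size w = n]].

Fixpoint derived (n : nat) : set G :=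
  if n is n'.+1 then
    generated [set g | exists a b, [/\ derived n' a, derived n' b & g = [~ a, b]]]
  else [set: G].

End GroupNotions.
Arguments derived : clear implicits.

Definition finitely_generated (G : groupType) :=
  exists2 X : set G, finite_set X & generates X.

Definition solvable_group (G : groupType) := exists n, derived G n = [set 1].

Definition infinite_cyclic (H : groupType) :=
  infinite_set [set: H] /\ exists a : H, generates [set a].

Definition distortion (H G : groupType) (phi : H -> G) (Y : set H) (X : set G)
    (r : nat) : nat :=
  set_max [set n | exists2 h, (word_length X (phi h) <= r)%N & word_length Y h = n].

(* The class of the distortion function modulo approx does not depend on the
   finite generating sets, so all of them are required to give f. *)
Definition distortion_approx (H G : groupType) (phi : H -> G) (f : nat -> nat) :=
  forall (Y : set H) (X : set G),
    finite_set Y -> generates Y -> finite_set X -> generates X ->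
    approx (distortion phi Y X) f.

Lemma set_minP (A : set nat) n : A n ->
  A (set_min A) /\ forall m, A m -> (set_min A <= m)%N.
Proof.
move=> An; suff [x [Ax xl]] : exists x, (A `&` lbound A) x.
  by have [] : (A `&` lbound A) (set_min A) by apply: xgetPex; exists x.
have exA : exists n, `[< A n >] by exists n; apply/asboolP.
exists (ex_minn exA); case: ex_minnP => m /asboolP Am ml.
by split=> // k Ak; apply: ml; apply/asboolP.
Qed.

Lemma set_maxP (A : set nat) n b : A n -> (forall m, A m -> (m <= b)%N) ->
  A (set_max A) /\ forall m, A m -> (m <= set_max A)%N.
Proof.
move=> An bA; suff [x [Ax xl]] : exists x, (A `&` ubound A) x.
  by have [] : (A `&` ubound A) (set_max A) by apply: xgetPex; exists x.
have exA : exists n, `[< A n >] by exists n; apply/asboolP.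
have bA' i : `[< A i >] -> (i <= b)%N by move=> /asboolP /bA.
exists (ex_maxn exA bA'); case: ex_maxnP => m /asboolP Am ml.
by split=> // k Ak; apply: ml; apply/asboolP.
Qed.

Lemma word_lengthP (G : groupType) (X : set G) (g : G) : generates X ->
  (exists w, [/\ is_word X w, \prod_(x <- w) x = g & size w = word_length X g])
  /\ forall w, is_word X w -> \prod_(x <- w) x = g -> (word_length X g <= size w)%N.
Proof.
move=> gX; have [w wX wg] : generated X g by rewrite gX.
have [|[w' w'P] min] := @set_minP
  [set n | exists w, [/\ is_word X w, \prod_(x <- w) x = g & size w = n]] (size w).
  by exists w.
split; first by exists w'.
by move=> v vX vg; apply: min; exists v.
Qed.

Lemma finite_words (G : groupType) (X : set G) (r : nat) : finite_set X ->
  finite_set [set w | is_word X w /\ (size w <= r)%N].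
Proof.
move=> fX; set A := X `|` (fun x => x^-1) @` X.
have fA : finite_set A by rewrite finite_setU; split=> //; apply: finite_image.
have wA w : is_word X w -> forall x, x \in w -> A x.
  by move=> wX x /wX [?|?]; [left|right; exists x^-1 => //; rewrite invgK].
apply: (@sub_finite_set _ _ [set w | (forall x, x \in w -> A x) /\ (size w <= r)%N]).
  by move=> w [/wA].
elim: r => [|r IH].
  by apply: (sub_finite_set _ (finite_set1 [::])) => w [_]; rewrite leqn0 => /nilP.
set B := [set w | _] in IH.
apply: (@sub_finite_set _ _ ([set [::]] `|` (fun p => p.1 :: p.2) @` (A `*` B))).
  move=> [|x w] /= [wx s]; [by left|right; exists (x, w) => //; split=> /=].
    by apply: wx; rewrite mem_head.
  by split=> // y yw; apply: wx; rewrite inE yw orbT.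
rewrite finite_setU; split; first exact: finite_set1.
by apply: finite_image; apply: finite_setX.
Qed.

Lemma distortionP (H G : groupType) (phi : UMagmaMorphism.type H G)
    (Y : set H) (X : set G) (r : nat) :
  injective phi -> finite_set X -> generates X ->
  (exists2 h, (word_length X (phi h) <= r)%N & word_length Y h = distortion phi Y X r)
  /\ forall h, (word_length X (phi h) <= r)%N ->
       (word_length Y h <= distortion phi Y X r)%N.
Proof.
move=> phiI fX gX; set S := [set h | (word_length X (phi h) <= r)%N].
have fS : finite_set S.
  rewrite -(eq_finite_set (inj_card_eq (in2W phiI))).
  apply: (sub_finite_set _ (finite_image (fun w => \prod_(x <- w) x)
    (finite_words r fX))) => _ [h Sh <-].
  have [[w [wX wg ws]] _] := word_lengthP (phi h) gX.
  by exists w => //; split=> //; rewrite ws.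
have S1 : S 1.
  rewrite /S /=; apply: leq_trans (leq0n r).
  have [_] := word_lengthP (phi 1) gX.
  by move/(_ [::]); apply=> //; rewrite big_nil gmulf1.
have /finite_seqP[s Ss] := fS.
have [|n [h Sh <-]|D max] := @set_maxP
    [set n | exists2 h, S h & word_length Y h = n]
    (word_length Y 1) (\max_(h <- s) word_length Y h)%N.
- by exists 1.
- by apply: leq_bigmax_seq => //; rewrite Ss in Sh.
- by split=> // h Sh; apply: max; exists h.
Qed.

(* Main.v *)
(* If a generates H and D is its distortion function, then D (r + s) >= D r + D s
   for every embedding of H, and D (|a| r) >= r makes r |-> D (|a| r) increasing.

   Conversely, given f, let G be the subgroup of the unrestricted wreath product
   D_oo Wr Z (solvable of length 3) generated by the shift t, the reflection x |-> -x
   at site 0, and an element b equal to the reflection x |-> f (2^i) - x at site 2^i,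
   for all i at once. Let a be the translation by 2 at site 0. Conjugating b by
   t^(2^i) brings f (2^i) to site 0, so that a^(f (2^i)) is a word of length O(2^i).
   For the upper bound, follow the orbit of (0, 0) under a word of length k: a
   translation by about f p + f q requires travelling between the sites p and q, which
   costs at least max(p, q) / 2 letters because the sites grow geometrically;
   superadditivity of f then bounds the total translation by f (2 k). *)
From HB Require Import structures.
From mathcomp Require Import all_boot all_order all_algebra.
From mathcomp Require Import boolp classical_sets functions cardinality.
From mathcomp Require Import zify.
Require Import Defs.

Set Implicit Arguments.
Unset Strict Implicit.
Unset Printing Implicit Defensive.

Import Order.TTheory GRing.Theory.
Local Open Scope classical_set_scope.
Local Open Scope group_scope.

(** * Words and word length *)

Section Words.
Variable G : groupType.
Implicit Types (X : set G) (g : G) (w : seq G).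

Lemma is_word_cat X w1 w2 : is_word X w1 -> is_word X w2 -> is_word X (w1 ++ w2).
Proof. by move=> h1 h2 x; rewrite mem_cat => /orP[/h1|/h2]. Qed.

Lemma is_word_cons X x w : is_word X (x :: w) <-> (X x \/ X x^-1) /\ is_word X w.
Proof.
split=> [h|[hx hw] y]; last by rewrite inE => /predU1P[->//|/hw].
by split=> [|y yw]; apply: h; rewrite inE ?eqxx // yw orbT.
Qed.

Lemma is_word_nseq X n x : X x \/ X x^-1 -> is_word X (nseq n x).
Proof. by move=> hx y /nseqP[->]. Qed.

Lemma is_word_rev_inv X w : is_word X w -> is_word X (rev [seq x^-1 | x <- w]).
Proof.
move=> hw y; rewrite mem_rev => /mapP[x /hw hx ->].
by rewrite invgK; case: hx; [right|left].
Qed.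

Lemma prod_rev_inv w : \prod_(x <- rev [seq x^-1 | x <- w]) x = (\prod_(x <- w) x)^-1.
Proof.
elim: w => [|x w IH]; first by rewrite !big_nil invg1.
by rewrite /= rev_cons -cats1 big_cat big_seq1 /= IH big_cons invgM.
Qed.

Lemma generated1 X : generated X 1.
Proof. by exists [::]; rewrite ?big_nil. Qed.

Lemma generatedM X g h : generated X g -> generated X h -> generated X (g * h).
Proof.
move=> [w wX <-] [v vX <-]; exists (w ++ v); last by rewrite big_cat.
exact: is_word_cat.
Qed.

Lemma generatedV X g : generated X g -> generated X g^-1.
Proof.
move=> [w wX <-]; exists (rev [seq x^-1 | x <- w]); last exact: prod_rev_inv.
exact: is_word_rev_inv.
Qed.

Lemma generated_sub X (P : set G) : P 1 -> (forall g h, P g -> P h -> P (g * h)) ->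
  (forall g, P g -> P g^-1) -> X `<=` P -> generated X `<=` P.
Proof.
move=> P1 PM PV XP _ [w wX <-]; elim: w wX => [|x w IH]; first by rewrite big_nil.
move=> /is_word_cons[hx /IH hw]; rewrite big_cons; apply: PM => //.
by case: hx => /XP // /PV; rewrite invgK.
Qed.

Lemma word_length_prod X w : generates X -> is_word X w ->
  (word_length X (\prod_(x <- w) x)%g <= size w)%N.
Proof. by move=> gX wX; have [_] := word_lengthP (\prod_(x <- w) x) gX; apply. Qed.

Lemma word_lengthE X g : generates X ->
  exists w, [/\ is_word X w, \prod_(x <- w) x = g & size w = word_length X g].
Proof. by move=> /(word_lengthP g)[]. Qed.

Lemma word_lengthM X g h : generates X ->
  (word_length X (g * h)%g <= word_length X g + word_length X h)%N.
Proof.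
move=> gX; have [w [wX <- <-]] := word_lengthE g gX.
have [v [vX <- <-]] := word_lengthE h gX.
rewrite -size_cat -big_cat; apply: word_length_prod => //; exact: is_word_cat.
Qed.

Lemma word_length1 X : generates X -> word_length X 1 = 0.
Proof.
move=> gX; apply/eqP; rewrite -leqn0 -[1](big_nil 1 *%g xpredT (@id G)).
exact: word_length_prod.
Qed.

Lemma word_lengthV X g : generates X -> word_length X g^-1 = word_length X g.
Proof.
move=> gX; apply/eqP; rewrite eqn_leq; suff le h : (word_length X h^-1 <= word_length X h)%N.
  by rewrite le -{1}[g]invgK le.
have [w [wX <- <-]] := word_lengthE h gX.
rewrite -prod_rev_inv -[size w](size_map (fun x : G => x^-1)) -size_rev.
by apply: word_length_prod => //; apply: is_word_rev_inv.
Qed.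

Lemma word_lengthX X g n : generates X -> (word_length X (g ^+ n) <= n * word_length X g)%N.
Proof.
move=> gX; elim: n => [|n IH]; first by rewrite expg0 word_length1.
by rewrite expgS mulSn; apply: leq_trans (word_lengthM _ _ gX) _; rewrite leq_add2l.
Qed.

Lemma word_length_eq0 X g : generates X -> word_length X g = 0 -> g = 1.
Proof.
by move=> gX; have [w [_ <- <-]] := word_lengthE g gX => /size0nil ->; rewrite big_nil.
Qed.

Lemma word_length_change X X' : finite_set X' -> generates X -> generates X' ->
  exists2 c, 0 < c & forall g, (word_length X g <= c * word_length X' g)%N.
Proof.
move=> /finite_seqP[s X's] gX gX'.
(* The successor keeps the constant positive when every element of [X'] has [X]-length 0. *)
exists (\max_(x <- s) word_length X x).+1 => // g.
have [w [wX' <- <-]] := word_lengthE g gX'.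
elim: w wX' => [|x w IH]; first by rewrite big_nil word_length1.
move=> /is_word_cons[hx /IH hw]; rewrite big_cons /= mulnS.
apply: leq_trans (word_lengthM _ _ gX) (leq_add _ hw); apply: leqW.
suff le y : X' y -> (word_length X y <= \max_(x <- s) word_length X x)%N.
  by case: hx => /le //; rewrite word_lengthV.
by rewrite X's => /= ys; apply: leq_bigmax_seq.
Qed.

End Words.

(** * Distortion under change of generating sets *)

Lemma preceq_trans f g k : preceq f g -> preceq g k -> preceq f k.
Proof.
move=> [c c0 fg] [d d0 gk]; exists (c * d)%N => [|r r0]; first by rewrite muln_gt0 c0.
apply: leq_trans (fg r r0) _; rewrite -mulnA leq_mul2l; apply/orP; right.
by rewrite (mulnC c d) -mulnA; apply: gk; rewrite muln_gt0 c0.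
Qed.

Section Distortion.
Variables (H G : groupType) (phi : UMagmaMorphism.type H G).
Hypothesis phiI : injective phi.
Implicit Types (Y : set H) (X : set G).

Lemma distortion_ge Y X r h : finite_set X -> generates X ->
  (word_length X (phi h) <= r)%N -> (word_length Y h <= distortion phi Y X r)%N.
Proof. by move=> fX gX; have [_] := distortionP Y r phiI fX gX; apply. Qed.

Lemma distortionE Y X r : finite_set X -> generates X ->
  exists2 h, (word_length X (phi h) <= r)%N & word_length Y h = distortion phi Y X r.
Proof. by move=> fX gX; have [] := distortionP Y r phiI fX gX. Qed.

Lemma distortion_mono Y X r s : finite_set X -> generates X -> (r <= s)%N ->
  (distortion phi Y X r <= distortion phi Y X s)%N.
Proof.
move=> fX gX rs; have [h hr <-] := distortionE Y r fX gX.
by apply: distortion_ge => //; apply: leq_trans rs.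
Qed.

(** Changing [Y] multiplies the values by a constant, and changing [X] rescales the radius.
    Exchanging the two pairs gives the reverse comparison. *)
Lemma distortion_change Y Y' X X' :
  generates Y -> finite_set Y' -> generates Y' ->
  finite_set X -> generates X -> finite_set X' -> generates X' ->
  preceq (distortion phi Y X) (distortion phi Y' X').
Proof.
move=> gY fY' gY' fX gX fX' gX'.
have [c c0 hc] := word_length_change fY' gY gY'.
have [d d0 hd] := word_length_change fX gX' gX.
exists (c * d)%N => [|r r0]; first by rewrite muln_gt0 c0.
have [h hr <-] := distortionE Y r fX gX.
apply: leq_trans (hc h) (leq_mul _ _); first by rewrite leq_pmulr.
apply: distortion_ge => //; apply: leq_trans (hd _) _.
by apply: leq_mul; rewrite ?leq_pmull.
Qed.

Lemma distortion_approx_indep Y X f :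
  finite_set Y -> generates Y -> finite_set X -> generates X ->
  approx (distortion phi Y X) f -> distortion_approx phi f.
Proof.
move=> fY gY fX gX [le ge] Y' X' fY' gY' fX' gX'.
by split; [apply: preceq_trans le|apply: (preceq_trans ge)]; apply: distortion_change.
Qed.

End Distortion.

Lemma superadditive_increasing f : maps_to_N f -> superadditive f -> increasing f.
Proof.
move=> fN fS r s r0 rs; rewrite -(subnKC (ltnW rs)).
apply: leq_trans (fS r (s - r) r0 _); last by rewrite subn_gt0.
by rewrite -addn1 leq_add2l; apply: fN; rewrite subn_gt0.
Qed.

(** * Exponents in an infinite cyclic group *)

Section CyclicLog.
Variable H : groupType.

Definition zpow (a : H) (m : int) : H :=
  match m with Posz n => a ^+ n | Negz n => a ^- n.+1 end.

Lemma zpow_succ a m : zpow a (1 + m)%R = a * zpow a m.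
Proof.
case: m => [n|[|n]]; first by rewrite -PoszD add1n /= expgS.
  by rewrite /= expg1 mulgV.
by rewrite (_ : (1 + _)%R = Negz n) ?expgSr /= 1?[in RHS]expgSr ?invgM ?mulVKg //; lia.
Qed.

Lemma zpow_pred a m : zpow a (m - 1)%R = a^-1 * zpow a m.
Proof. by rewrite -{2}[m](subrKC 1) zpow_succ mulKg. Qed.

Lemma zpowD a m n : zpow a (m + n)%R = zpow a m * zpow a n.
Proof.
have zpowP k : zpow a (k%:Z + n)%R = zpow a k%:Z * zpow a n.
  elim: k => [|k IH]; first by rewrite add0r mul1g.
  by rewrite -add1n PoszD -addrA !zpow_succ IH mulgA.
case: m => k; first exact: zpowP.
elim: k => [|k IH].
  by rewrite (_ : (_ + n)%R = (n - 1)%R) ?zpow_pred ?expg1 /= ?expg1 //; lia.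
rewrite (_ : (_ + n)%R = (Negz k + n - 1)%R); last by lia.
by rewrite zpow_pred IH (_ : Negz k.+1 = (Negz k - 1)%R) ?zpow_pred ?mulgA //; lia.
Qed.

Lemma zpowN a m : zpow a (- m)%R = (zpow a m)^-1.
Proof. by apply/esym/mulg1_eq; rewrite -zpowD subrr. Qed.

Lemma zpow_word a w : is_word [set a] w ->
  exists2 m, \prod_(x <- w) x = zpow a m & (absz m <= size w)%N.
Proof.
elim: w => [|x w IH]; first by exists 0%R; rewrite ?big_nil.
move=> /is_word_cons[hx /IH[m wm sm]]; rewrite big_cons wm.
case: hx => [->|ax]; first by exists (1 + m)%R; rewrite ?zpow_succ //=; lia.
exists (m - 1)%R; last by rewrite /=; lia.
by rewrite zpow_pred -(invgK x) ax.
Qed.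

Lemma zpow_surj a h : generates [set a] -> exists m, zpow a m = h.
Proof.
move=> ga; have [w wa <-] : generated [set a] h by rewrite ga.
by have [m -> _] := zpow_word wa; exists m.
Qed.

(** If a positive power of [a] were trivial, exponents could be reduced modulo it, leaving finitely
    many elements. *)
Lemma zpow_inj a : infinite_set [set: H] -> generates [set a] -> injective (zpow a).
Proof.
move=> iH ga; suff kP k : zpow a k.+1%:Z <> 1.
  move=> m n mn; have : zpow a (m - n)%R = 1 by rewrite zpowD zpowN mn mulgV.
  case E : (m - n)%R => [[|k]|k]; first by move=> _; apply/eqP; rewrite -subr_eq0 E.
    by move/kP.
  by move=> /= k1; case: (kP k); rewrite /= -[LHS]invgK k1 invg1.
move=> k1; apply: iH.
apply: (@sub_finite_set _ _ ((fun i => a ^+ i) @` `I_k.+1)); last exact/finite_image.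
move=> h _; have [m <-] := zpow_surj h ga.
have zM j : zpow a (j * k.+1%:Z)%R = 1.
  have zMn i : zpow a (i%:Z * k.+1%:Z)%R = 1.
    elim: i => [|i IH]; first by rewrite mul0r.
    by rewrite -add1n PoszD mulrDl mul1r zpowD IH k1 mulg1.
  by case: j => i //; rewrite NegzE mulNr zpowN zMn invg1.
have r0 := modz_ge0 m (isT : (k.+1%:Z != 0)%R).
exists (absz (m %% k.+1%:Z)%Z).
  by have := ltz_pmod m (isT : (0 < k.+1%:Z)%R); move: r0 => /=; lia.
rewrite (_ : _ ^+ _ = zpow a (m %% k.+1%:Z)%Z); first last.
  by move: r0; case: (m %% k.+1%:Z)%Z.
suff {2}-> : m = ((m %/ k.+1%:Z)%Z * k.+1%:Z + (m %% k.+1%:Z)%Z)%R.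
  by rewrite [RHS]zpowD zM mul1g.
exact: divz_eq.
Qed.

(** Turns questions about lengths in [H] into questions about absolute values of integers. *)
Lemma infinite_cyclicP : infinite_cyclic H ->
  exists (a : H) (log : H -> int), [/\ generates [set a], cancel log (zpow a),
    cancel (zpow a) log, {morph log : x y / x * y >-> (x + y)%R}
    & forall h, word_length [set a] h = absz (log h)].
Proof.
move=> [iH [a ga]]; have aI := zpow_inj iH ga.
have [log logK] := choice (fun h => zpow_surj h ga).
have zK : cancel (zpow a) log by move=> m; apply: aI; rewrite logK.
exists a, log; split=> // [x y|h]; first by apply: aI; rewrite zpowD !logK.
apply/eqP; rewrite eqn_leq; apply/andP; split; last first.
  have [w [wa wh <-]] := word_lengthE h ga.
  by have [m + sm] := zpow_word wa; rewrite wh => ->; rewrite zK.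
have zle n : (word_length [set a] (a ^+ n) <= n)%N.
  apply: leq_trans (word_lengthX a n ga) _; rewrite -[leqRHS]muln1 leq_mul2l.
  apply/orP; right; have := @word_length_prod _ [set a] [:: a] ga.
  by rewrite big_seq1; apply=> x; rewrite inE => /eqP ->; left.
rewrite -{1}[h]logK; case: (log h) => n //=.
by rewrite word_lengthV.
Qed.

End CyclicLog.

(** * Generated subgroups, and derived series seen through an embedding *)

Section GeneratedGroup.
Variables (W : groupType) (S : set W).

Definition generatedb : pred W := fun g => `[< generated S g >].

Lemma generatedb_group : group_closed generatedb.
Proof.
split=> [|g h /asboolP gS /asboolP hS]; apply/asboolP; first exact: generated1.
by apply: generatedM => //; apply: generatedV.
Qed.

Definition generated_group := {g : W | generatedb g}.
HB.instance Definition _ := Choice.on generated_group.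
HB.instance Definition _ := SubType.on generated_group.
HB.instance Definition _ :=
  SubChoice_isSubGroup.Build W generatedb generated_group generatedb_group.

End GeneratedGroup.

(** Hides the subtype: later arguments use only an injective morphism with known range. *)
Lemma generated_group_embedding (W : groupType) (S : set W) :
  exists (G : groupType) (iota : UMagmaMorphism.type G W),
    injective iota /\ range iota = generated S.
Proof.
exists (generated_group S), (val : UMagmaMorphism.type _ _); split; first exact: val_inj.
apply/seteqP; split=> [_ [g _ <-]|g gS]; first exact/asboolP/(valP g).
by exists (Sub g (introT (asboolP _) gS)); rewrite ?SubK.
Qed.

Section Embedding.
Variables (G W : groupType) (iota : UMagmaMorphism.type G W).
Hypothesis iotaI : injective iota.

Lemma is_word_preimage (S : set W) w :
  is_word (iota @^-1` S) w -> is_word S (map iota w).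
Proof. by move=> wS _ /mapP[x /wS + ->]; rewrite /= gmulfV. Qed.

Lemma lift_word (S : set W) w : S `<=` range iota -> is_word S w ->
  exists2 v, is_word (iota @^-1` S) v & map iota v = w.
Proof.
move=> Siota; elim: w => [|x w IH]; first by exists [::].
move=> /is_word_cons[hx /IH[v vS <-]].
have [y yx] : exists y, iota y = x.
  case: hx => /Siota[y _ yx]; first by exists y.
  by exists y^-1; rewrite gmulfV yx invgK.
exists (y :: v); last by rewrite /= yx.
by apply/is_word_cons; split=> //=; rewrite gmulfV yx.
Qed.

Lemma generates_preimage (S : set W) : range iota = generated S ->
  generates (iota @^-1` S).
Proof.
move=> rS; apply/seteqP; split=> // g _.
have Siota : S `<=` range iota.
  move=> x Sx; rewrite rS; exists [:: x]; last by rewrite big_seq1.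
  by apply/is_word_cons; split; [left|].
have [w wS wg] : generated S (iota g) by rewrite -rS; exists g.
have [v vS vw] := lift_word Siota wS; exists v => //.
by apply: iotaI; rewrite gmulf_prod -wg -vw big_map.
Qed.

Lemma solvable_preimage n (P : set W) :
  (forall g, derived G n g -> P (iota g)) -> P `<=` [set 1] -> solvable_group G.
Proof.
move=> dP P1; exists n; apply/seteqP; split=> g /=; last first.
  by move=> ->; case: n {dP} => //= n; apply: generated1.
by move/dP/P1 => /= g1; apply: iotaI; rewrite g1 gmulf1.
Qed.

End Embedding.

(** One step down the derived series of [G], bounded from outside: [Q] need only be closed under the
    group operations and contain the commutators of [P]. *)
Lemma derived_preimage (G W : groupType) (iota : UMagmaMorphism.type G W) n
    (P Q : set W) :
  (forall g, derived G n g -> P (iota g)) ->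
  Q 1 -> (forall g h, Q g -> Q h -> Q (g * h)) -> (forall g, Q g -> Q g^-1) ->
  (forall g h, P g -> P h -> Q [~ g, h]) ->
  forall g, derived G n.+1 g -> Q (iota g).
Proof.
move=> dP Q1 QM QV PQ; apply: (@generated_sub _ _ (iota @^-1` Q)) => /=.
- by rewrite gmulf1.
- by move=> g h gQ hQ; rewrite gmulfM; apply: QM.
- by move=> g gQ; rewrite gmulfV; apply: QV.
- by move=> _ [a [b [/dP aP /dP bP ->]]]; rewrite /= gmulfR; apply: PQ.
Qed.

(** * The wreath product of the infinite dihedral group by the integers *)

Section Wreath.

Definition signed (b : bool) (x : int) : int := if b then (- x)%R else x.

(* The unrestricted wreath product of the infinite dihedral group by Z: an element
   acts on Z x Z by (n, x) |-> (n + shift, +-x + trans n), with sign - when flip n. *)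
Record wreath := Wreath { shift : int; flip : int -> bool; trans : int -> int }.

Definition tuple_of_wreath g := (shift g, flip g, trans g).
Definition wreath_of_tuple p := Wreath p.1.1 p.1.2 p.2.
Lemma tuple_of_wreathK : cancel tuple_of_wreath wreath_of_tuple. Proof. by case. Qed.
HB.instance Definition _ := Choice.copy wreath (can_type tuple_of_wreathK).

Lemma wreath_eq g h :
  shift g = shift h -> flip g =1 flip h -> trans g =1 trans h -> g = h.
Proof. by case: g => a b c; case: h => a' b' c' /= -> /funext -> /funext ->. Qed.

Definition wreath_one := Wreath 0 xpred0 (fun=> 0%R).
Definition wreath_mul g h :=
  Wreath (shift g + shift h)
    (fun n => flip g (n + shift h)%R (+) flip h n)
    (fun n => signed (flip g (n + shift h)%R) (trans h n) + trans g (n + shift h))%R.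
Definition wreath_inv g :=
  Wreath (- shift g) (fun n => flip g (n - shift g)%R)
    (fun n => - signed (flip g (n - shift g)%R) (trans g (n - shift g)))%R.

Lemma wreath_mulA : associative wreath_mul.
Proof.
move=> g h k; apply: wreath_eq => [|n|n] /=; rewrite ?addrA //;
  rewrite [(n + shift h + _)%R]addrAC ?addbA //.
by case: (flip g _); case: (flip h _); rewrite /= ?opprD ?opprK ?addrA.
Qed.

Lemma wreath_mul1 : left_id wreath_one wreath_mul.
Proof. by move=> g; apply: wreath_eq => [|n|n] /=; rewrite ?add0r ?addr0. Qed.

Lemma wreath_mulr1 : right_id wreath_one wreath_mul.
Proof.
move=> g; apply: wreath_eq => [|n|n] /=; rewrite ?addr0 ?addbF //.
by case: (flip _ _); rewrite /= ?oppr0 add0r.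
Qed.

Lemma wreath_mulV : left_inverse wreath_one wreath_inv wreath_mul.
Proof.
move=> g; apply: wreath_eq => [|n|n] /=; rewrite ?addNr ?addrK ?addbb //.
by rewrite subrr.
Qed.

Lemma wreath_mulrV : right_inverse wreath_one wreath_inv wreath_mul.
Proof.
move=> g; apply: wreath_eq => [|n|n] /=; rewrite ?subrr ?addbb //.
by case: (flip _ _); rewrite /= ?opprK ?addNr ?subrr.
Qed.

HB.instance Definition _ := isGroup.Build wreath wreath_mulA wreath_mul1 wreath_mulr1
  wreath_mulV wreath_mulrV.

Definition act (g : wreath) (p : int * int) : int * int :=
  (p.1 + shift g, signed (flip g p.1) p.2 + trans g p.1)%R.

Lemma actM g h p : act (g * h) p = act g (act h p).
Proof.
case: p => n x; rewrite /act /= -addrA [(shift h + _)%R]addrC; congr pair.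
by case: (flip g _); case: (flip h _) => /=; lia.
Qed.

Lemma act1 p : act 1 p = p.
Proof. by case: p => n x; rewrite /act /= !addr0. Qed.

(** The images of the points [(n, 0)] determine the shift and the translations; those of [(n, 1)]
    then determine the signs. *)
Lemma act_inj g h : act g =1 act h -> g = h.
Proof.
move=> gh; have [e0 e1] : (forall n, act g (n, 0%R) = act h (n, 0%R)) /\
  (forall n, act g (n, 1%R) = act h (n, 1%R)) by [].
have mgh n : trans g n = trans h n.
  by case: (e0 n) => _; case: (flip g n); case: (flip h n) => /=; lia.
apply: wreath_eq => [|n|n]; [by case: (e0 0%R); lia| |exact: mgh].
by case: (e1 n) => _; rewrite mgh; case: (flip g n); case: (flip h n) => //=; lia.
Qed.

Lemma act_prod w p : act (\prod_(g <- w) g) p = foldr act p w.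
Proof. by elim: w => [|g w IH]; rewrite ?big_nil ?act1 // big_cons actM IH. Qed.

(** Commutators have shift 0; commutators of elements of shift 0 have no flips, since signs commute
    at each site; pure translations commute. *)
Lemma wreath_solvable (G : groupType) (iota : UMagmaMorphism.type G wreath) :
  injective iota -> solvable_group G.
Proof.
move=> iotaI; pose P1 g := shift g = 0%R.
pose P2 g := P1 g /\ flip g =1 xpred0.
have d1 g : derived G 1 g -> P1 (iota g).
  apply: (@derived_preimage _ _ _ _ setT) => //=; rewrite /P1 //=.
  - by move=> {}g h -> ->.
  - by move=> {}g ->.
  - by move=> {}g h _ _ /=; lia.
have d2 g : derived G 2 g -> P2 (iota g).
  apply: (@derived_preimage _ _ _ 1 P1 P2 d1) => //=; rewrite /P2 /P1 /=.
  - by move=> {}g h [g0 g1] [h0 h1]; rewrite g0 h0; split=> // n; rewrite g1 h1.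
  - by move=> {}g [g0 g1]; rewrite g0; split=> // n; rewrite g1.
  - move=> {}g h g0 h0; rewrite g0 h0; split=> // n.
    by rewrite !(oppr0, addr0); case: (flip g n); case: (flip h n).
apply: (@solvable_preimage _ _ _ iotaI 3 [set 1]) => //.
apply: (@derived_preimage _ _ _ 2 P2 [set 1] d2) => //=.
- by move=> g h -> ->; rewrite mulg1.
- by move=> g ->; rewrite invg1.
- move=> g h [g0 g1] [h0 h1]; apply: wreath_eq => [|n|n] /=; rewrite g0 h0 //.
    by rewrite !g1 !h1.
  rewrite !(oppr0, addr0) !g1 !h1 /=.
  by rewrite [(trans h n + _)%R]addrC addrK subrr.
Qed.

(** * Shift, reflections and sparse sites *)

Definition unit_shift := Wreath 1 xpred0 (fun=> 0%R).
Definition mirror := Wreath 0 (fun n => n == 0%R) (fun=> 0%R).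

Definition power2 (n : int) :=
  if n is Posz k then k == (2 ^ trunc_log 2 k)%N else false.

Lemma power2P (n : int) : reflect (exists i, n = (2 ^ i)%N) (power2 n).
Proof.
apply: (iffP idP) => [|[i ->]]; last by rewrite /power2 trunc_expnK.
by case: n => //= k /eqP kE; exists (trunc_log 2 k); rewrite -kE.
Qed.

Definition site n := (n == 0%R) || power2 n.

(** Two distinct powers of 2 differ by at least half of the larger one, and by at least the smaller
    one. *)
Lemma site_sparse p q : site p -> site q -> p <> q -> (absz p <= 2 * absz (q - p)%R)%N.
Proof.
have le i j : i < j -> (2 * 2 ^ i <= 2 ^ j)%N by rewrite -expnS leq_exp2l.
move=> /orP[/eqP->|/power2P[i ->]] /orP[/eqP->|/power2P[j ->]] // ij; try lia.
by case: (ltngtP i j) ij => [/le|/le|->] //; lia.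
Qed.

(** The translation is by [2 m] because [spike_word] squares a product of two reflections. *)
Definition spike (m : int) :=
  Wreath 0 xpred0 (fun n => if n == 0%R then (m + m)%R else 0%R).

Lemma spikeD m n : spike (m + n) = spike m * spike n.
Proof.
apply: wreath_eq => //= k; rewrite addr0; case: eqP => //= _; lia.
Qed.

(** * The generators attached to [f], and the bound on translations by short words *)

Variable f : nat -> nat.
Hypotheses (f_pos : maps_to_N f) (f_super : superadditive f).

(* The value 1 rather than f 1 at site 1 puts [spike 1] itself into the group. *)
Definition site_value (n : int) : int :=
  if power2 n then (if n == 1%R then 1%N else f (absz n)) else 0%R.

Definition mirrors := Wreath 0 power2 site_value.

Definition gens : set wreath := [set unit_shift; mirror; mirrors].

(* [f 0] is an irrelevant junk value. *)
Definition f_ext n := if n == 0 then 0 else f n.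

(** The value 0 at 0 extends superadditivity to zero arguments, so an exhausted budget needs no
    separate case. *)
Lemma f_extD m n : (f_ext m + f_ext n <= f_ext (m + n))%N.
Proof. by case: m n => [|m] [|n] //=; rewrite ?addn0 //; apply: f_super. Qed.

Lemma f_ext_mono m n : (m <= n)%N -> (f_ext m <= f_ext n)%N.
Proof. by move=> mn; rewrite -(subnKC mn); apply: leq_trans (f_extD _ _); apply: leq_addr. Qed.

Lemma site_value_le n : (absz (site_value n) <= f_ext (absz n))%N.
Proof.
rewrite /site_value; case: ifP => // /power2P[i ->] /=.
(* At site 1 the value is 1, and [f_pos] gives [1 <= f 1]. *)
by rewrite /f_ext expn_eq0 /=; case: eqP => // [[->]]; apply: f_pos.
Qed.

(* Invariant after k letters: q is the last site at which a reflection was applied,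
   and applying it again toggles x between y and [site_value q - y]; the bound on y
   leaves out the letters spent since then on moving away from q. *)
Definition reach k (p : int * int) := exists q y : int,
  [/\ site q, p.2 = y \/ p.2 = (site_value q - y)%R, (absz (p.1 - q)%R <= k)%N
    & (absz y <= f_ext (2 * (k - absz (p.1 - q)%R)))%N].

(** A move away from [q] consumes exactly the letter just spent, so the budget in the bound on [y]
    never decreases. The case [n' = n] covers letters that fix the point. *)
Lemma reach_step k n n' x : (absz (n' - n)%R <= 1)%N ->
  reach k (n, x) -> reach k.+1 (n', x).
Proof.
move=> nn' [q [y [sq xy /= kq yk]]]; exists q, y; split=> //=; first by lia.
by apply: leq_trans yk (f_ext_mono _); lia.
Qed.

(** By [site_sparse], the travel cost [2 * |n - q|] left out of the bound on [y] is at least [|q|],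
    so it pays for [site_value q]; superadditivity merges the two terms. *)
Lemma reach_bound k n x q y : site q -> x = y \/ x = (site_value q - y)%R ->
  (absz (n - q)%R <= k)%N -> (absz y <= f_ext (2 * (k - absz (n - q)%R)))%N ->
  site n -> n <> q -> (absz x <= f_ext (2 * k))%N.
Proof.
move=> sq xy kq yk sn nq.
have := site_sparse sq sn (nesym nq) => qn.
have le : (f_ext (2 * (k - absz (n - q)%R)) + f_ext (absz q) <= f_ext (2 * k))%N.
  by apply: leq_trans (f_extD _ _) (f_ext_mono _); lia.
by have := site_value_le q; move: yk; case: xy => ->; lia.
Qed.

(** At [q] itself the reflection exchanges the two alternatives for [x]. At another site, [n]
    becomes the new [q] and [x] the new [y], which [reach_bound] allows. *)
Lemma reach_flip k n x : site n -> reach k (n, x) -> reach k.+1 (n, site_value n - x)%R.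
Proof.
move=> sn [q [y [sq /= xy kq yk]]]; have [nq|nq] := eqVneq n q.
  exists q, y; split=> //=; first by rewrite nq; case: xy => ->; [right|left; lia].
    by apply: leqW.
  by apply: leq_trans yk (f_ext_mono _); lia.
exists n, x; split=> //=; [by right|by rewrite subrr|rewrite subrr subn0].
have h := reach_bound sq xy kq yk sn (elimN eqP nq).
by apply: leq_trans h (f_ext_mono _); lia.
Qed.

Lemma reach_gens k g p : gens g \/ gens g^-1 -> reach k p -> reach k.+1 (act g p).
Proof.
(* The condition on [trans] forces translation 0 wherever there is no flip, so [h] is the identity
   or a reflection at each site. *)
have inv0 h : shift h = 0%R ->
    (forall n, trans h n = signed (~~ flip h n) (trans h n)) -> h^-1 = h.
  move=> h0 hm; apply: wreath_eq => [|n|n] /=; rewrite h0 ?subr0 // [in RHS]hm.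
  by case: (flip h n) => //=; rewrite opprK.
have mirrorV : mirror^-1 = mirror by apply: inv0 => //= n; case: eqP; rewrite /= ?oppr0.
have mirrorsV : mirrors^-1 = mirrors.
  by apply: inv0 => //= n; rewrite /site_value; case: (power2 n); rewrite /= ?oppr0.
case: p => n x gS; 
have {gS} : [\/ g = unit_shift, g = unit_shift^-1, g = mirror | g = mirrors].
  have gV h : g^-1 = h -> g = h^-1 by move=> <-; rewrite invgK.
  case: gS => [[[]|]|[[|]/gV|/gV]] => ->; rewrite ?mirrorV ?mirrorsV.
  - by constructor 1.
  - by constructor 3.
  - by constructor 4.
  - by constructor 2.
  - by constructor 3.
  - by constructor 4.
case=> ->; rewrite /act /= ?addr0 ?oppr0.
- by apply: reach_step; lia.
- by apply: reach_step; lia.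
(* At site 0 this is the reflection with [site_value 0 = 0]; elsewhere the point is fixed. *)
- case: eqP => [->|] /=; last by move=> _; apply: reach_step; lia.
  by move/(@reach_flip k 0%R x isT); rewrite sub0r.
- have [pn|/negbTE pn] := boolP (power2 n); last first.
    by rewrite /site_value pn addr0; apply: reach_step; lia.
  by rewrite addrC; apply: reach_flip; rewrite /site pn orbT.
Qed.

Lemma reach_word w p : is_word gens w -> reach 0 p -> reach (size w) (foldr act p w).
Proof.
move=> + p0; elim: w => [|g w IH] // /is_word_cons[hg /IH]; exact: reach_gens.
Qed.

(** The orbit of [(0, 0)] ends at [(0, 2 m)], where the invariant bounds [2 m]. *)
Lemma spike_length_ge w m : is_word gens w -> \prod_(g <- w) g = spike m ->
  (absz m <= f_ext (2 * size w))%N.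
Proof.
move=> wS wm; have : reach 0 (0%R, 0%R) by exists 0%R, 0%R; split=> //; left.
move=> /(reach_word wS); rewrite -act_prod wm /act /= !add0r.
move=> [q [y [sq /= xy kq yk]]]; apply: (@leq_trans (absz (m + m)%R)).
  by clear; lia.
(* If the last site is 0, its value is 0 and no travel is deducted, so the bound on [y] is the
   claim. *)
have [q0|/eqP q0] := eqVneq 0%R q; last exact: reach_bound sq xy kq yk isT q0.
by case: xy yk kq => ->; rewrite -q0 /= subn0 ?abszN // sub0r abszN.
Qed.

(** * Short words for large translations *)

(** The conjugate [c] of [mirrors] carries the reflection at site [2 ^ i] to site 0, and the word is
    [c mirror] squared. At site 0 this squares a translation by the site value; elsewhere [mirror]
    is trivial and the involution [c] cancels itself. *)
Definition spike_word i :=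
  let c := nseq (2 ^ i) unit_shift^-1 ++ mirrors :: nseq (2 ^ i) unit_shift in
  c ++ mirror :: c ++ [:: mirror].

Lemma spike_word_gens i : is_word gens (spike_word i).
Proof.
have TS : gens unit_shift by do 2!left.
have mirrorS : gens mirror by left; right.
have mirrorsS : gens mirrors by right.
have cS : is_word gens (nseq (2 ^ i) unit_shift^-1 ++ mirrors :: nseq (2 ^ i) unit_shift).
  apply: is_word_cat; first by apply: is_word_nseq; right; rewrite invgK.
  by apply/is_word_cons; split; [left|apply: is_word_nseq; left].
apply: is_word_cat => //; apply/is_word_cons; split; first by left.
by apply: is_word_cat => //; apply/is_word_cons; split; first by left.
Qed.

Lemma size_spike_word i : (size (spike_word i) = 4 * 2 ^ i + 4)%N.
Proof.
by rewrite /spike_word !(size_cat, size_nseq) /= !(size_cat, size_nseq) /= size_nseq; lia.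
Qed.

Lemma spike_wordE i : \prod_(g <- spike_word i) g = spike (site_value (2 ^ i)%N).
Proof.
have TE k p : foldr act p (nseq k unit_shift) = (p.1 + k%:Z, p.2)%R.
  by elim: k => [|k IH] /=; rewrite ?IH /act /= ?addr0; [case: p|congr pair; lia].
have TVE k p : foldr act p (nseq k unit_shift^-1) = (p.1 - k%:Z, p.2)%R.
  by elim: k => [|k IH] /=; rewrite ?IH /act /= ?addr0; [case: p|congr pair; lia].
have cE k n x : foldr act (n, x) (nseq k unit_shift^-1 ++ mirrors :: nseq k unit_shift) =
    (n, signed (power2 (n + k%:Z)) x + site_value (n + k%:Z))%R.
  by rewrite foldr_cat /= TE TVE /act /= addr0 addrK.
have mirrorE n x : act mirror (n, x) = (n, signed (n == 0%R) x) by rewrite /act /= !addr0.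
apply: act_inj => -[n x]; rewrite act_prod /spike_word.
rewrite foldr_cat [foldr _ _ (_ :: _)]/= foldr_cat [foldr _ _ [:: _]]/= mirrorE !(cE, mirrorE).
rewrite /act /= addr0; congr pair; case: eqP => [->|_].
  have -> : power2 (0 + (2 ^ i)%N%:Z)%R by rewrite add0r; apply/power2P; exists i.
  by rewrite add0r; move: (site_value _) => v /=; lia.
rewrite /= addr0 /site_value; case: (power2 _) => /=; last by rewrite !addr0.
by rewrite opprD opprK subrK addr0.
Qed.

Lemma spike_generated m : generated gens (spike m).
Proof.
have s1 : generated gens (spike 1%R).
  (* Site [2 ^ 0 = 1] carries the value 1. *)
  exists (spike_word 0); first exact: spike_word_gens.
  by rewrite spike_wordE.
have spikeN n : spike (- n) = (spike n)^-1.
  apply/esym/mulg1_eq; rewrite -spikeD subrr.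
  by apply: wreath_eq => //= k; case: ifP.
have sn n : generated gens (spike n%:Z).
  elim: n => [|n IH]; last by rewrite -addn1 PoszD spikeD; apply: generatedM.
  rewrite (_ : Posz 0 = (1 - 1)%R) // spikeD spikeN.
  by apply: generatedM; last apply: generatedV.
by case: m => n //; rewrite NegzE spikeN; apply: generatedV.
Qed.

End Wreath.

(** * Realizing a given superadditive function *)

Lemma realize_distortion (H : groupType) (f : nat -> nat) :
  infinite_cyclic H -> maps_to_N f -> increasing f -> superadditive f ->
  exists (G : groupType) (phi : UMagmaMorphism.type H G),
    [/\ injective phi, finitely_generated G, solvable_group G & distortion_approx phi f].
Proof.
move=> Hcyc f_pos f_incr f_super.
have [a [log [ga logK zK logM len]]] := infinite_cyclicP Hcyc.
have [G [iota [iotaI iotaR]]] := generated_group_embedding (gens f).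
pose X := iota @^-1` gens f.
have gX : generates X := generates_preimage iotaI iotaR.
have fX : finite_set X.
  apply: finite_preimage; first by move=> ? ? _ _; apply: iotaI.
  by rewrite /gens !finite_setU; do !split; apply: finite_set1.
have Sr : gens f `<=` range iota.
  move=> x Sx; rewrite iotaR; exists [:: x]; last by rewrite big_seq1.
  by apply/is_word_cons; split; [left|].
have /choice[phi0 phi0E] : forall h, exists g, iota g = spike (log h).
  move=> h; have : range iota (spike (log h)) by rewrite iotaR; apply: spike_generated.
  by move=> [g _ gE]; exists g.
have phi0M : {morph phi0 : x y / x * y}.
  by move=> x y; apply: iotaI; rewrite gmulfM !phi0E logM spikeD.
have phi01 : phi0 1 = 1 by apply: (mulgI (phi0 1)); rewrite -phi0M !mulg1.
pose phi : UMagmaMorphism.type H G :=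
  HB.pack phi0 (isUMagmaMorphism.Build H G phi0 (phi01, phi0M)).
have phiE h : iota (phi h) = spike (log h) := phi0E h.
have phiI : injective phi.
  move=> x y /(congr1 iota); rewrite !phiE => /(congr1 (fun g => trans g 0%R)) /= xy.
  by apply: (can_inj logK); lia.
exists G, phi; split=> //; [by exists X|exact: wreath_solvable iotaI|].
apply: (@distortion_approx_indep _ _ _ phiI [set a] X) => //.
split.
  (* The 2 comes from the argument of [f_ext] in [spike_length_ge]; the outer factor only weakens
     the bound. *)
  exists 2 => // r r0; have [h hr <-] := distortionE phiI [set a] r fX gX.
  have [w [wX wh sw]] := word_lengthE (phi h) gX.
  have := spike_length_ge f_pos f_super (is_word_preimage wX).
  move=> /(_ (log h)); rewrite -phiE -wh gmulf_prod big_map => /(_ erefl).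
  rewrite size_map len => le; apply: leq_trans le _.
  apply: leq_trans (f_ext_mono f_super (_ : _ <= 2 * r)%N) _.
    by rewrite leq_mul2l sw hr.
  by rewrite /f_ext; case: ifP => //; rewrite leq_pmull.
(* With [2 ^ i <= 2 * r] the spike word has length at most [8 * r + 4], below [16 * r]. The strict
   [r < 2 ^ i] avoids the exceptional site 1 and gives [f r < f (2 ^ i)]. *)
exists 16 => // r r0; pose i := (trunc_log 2 r).+1.
have /andP[ri ir] : (r < 2 ^ i <= 2 * r)%N.
  by rewrite /i trunc_log_ltn //= expnS leq_mul2l /= trunc_logP.
pose m := site_value f (2 ^ i)%N.
have mE : m = f (2 ^ i)%N.
  rewrite /m /site_value (introT (power2P _)); last by exists i.
  by case: eqP => //; lia.
have [v vX vE] := lift_word Sr (@spike_word_gens f i).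
have vphi : \prod_(g <- v) g = phi (zpow a m).
  by apply: iotaI; rewrite phiE zK /m -spike_wordE -vE gmulf_prod big_map.
have : (word_length X (phi (zpow a m)) <= 16 * r)%N.
  rewrite -vphi; apply: leq_trans (word_length_prod gX vX) _.
  have := size_spike_word f i; rewrite -vE size_map => ->; lia.
move=> /(distortion_ge phiI [set a] fX gX); rewrite len zK mE /= => le.
apply: leq_trans (leq_trans le (leq_pmull _ _)) => //.
by apply/ltnW/f_incr.
Qed.

(** * Superadditivity of every distortion function of an infinite cyclic group *)

Lemma distortion_superadditive (H G : groupType) (phi : UMagmaMorphism.type H G) :
  infinite_cyclic H -> injective phi -> finitely_generated G ->
  exists f : nat -> nat,
    [/\ maps_to_N f, increasing f, superadditive f & distortion_approx phi f].
Proof.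
move=> Hcyc phiI [X fX gX].
have [a [log [ga logK zK logM len]]] := infinite_cyclicP Hcyc.
(* The maximum is attained at a power of [a] with nonnegative exponent, since inversion preserves
   both lengths. Multiplying two such powers adds the exponents without cancellation, whence
   [DD]. *)
pose D := distortion phi [set a] X; pose c := word_length X (phi a).
have DE r : exists2 n, (word_length X (phi (zpow a n%:Z)) <= r)%N & D r = n.
  have [h hr hD] := distortionE phiI [set a] r fX gX.
  exists (D r) => //; rewrite /D -hD len; move: hr; rewrite -{1}[h]logK.
  by case: (log h) => n //=; rewrite gmulfV word_lengthV.
have D_le n r : (word_length X (phi (zpow a n%:Z)) <= r)%N -> (n <= D r)%N.
  by move=> /(distortion_ge phiI [set a] fX gX); rewrite len zK.
have DD r s : (D r + D s <= D (r + s))%N.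
  have [m mr ->] := DE r; have [n ns ->] := DE s; apply: D_le.
  rewrite PoszD zpowD gmulfM.
  exact: leq_trans (word_lengthM _ _ gX) (leq_add mr ns).
have c0 : 0 < c.
  rewrite lt0n; apply/eqP => /(word_length_eq0 gX) phia.
  have : a = 1 by apply: phiI; rewrite phia gmulf1.
  by move/(congr1 log); rewrite -{1}(expg1 a) -(expg0 a) (zK 1%N) (zK 0%N).
(* [D] may vanish at small radii; at radius [c * r] the generator [a], whose image has length [c],
   already counts. *)
have fN : maps_to_N (fun r => D (c * r)%N).
  move=> r r0; apply: D_le; rewrite /= expg1; exact: leq_pmulr.
have fS : superadditive (fun r => D (c * r)%N).
  by move=> r s _ _; rewrite mulnDr; apply: DD.
exists (fun r => D (c * r)%N); split=> //; first exact: superadditive_increasing.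
apply: (@distortion_approx_indep _ _ _ phiI [set a] X) => //.
split; last by exists c => // r r0; apply: leq_pmull.
by exists 1%N => // r r0; rewrite !mul1n; apply: distortion_mono; rewrite ?leq_pmull.
Qed.

Theorem corollary2p4 (H : groupType) (Hcyc : infinite_cyclic H) :
  [/\ forall (G : groupType) (phi : UMagmaMorphism.type H G),
        injective phi -> finitely_generated G ->
        exists f : nat -> nat,
          [/\ maps_to_N f, increasing f, superadditive f & distortion_approx phi f],
      forall f : nat -> nat, maps_to_N f -> increasing f -> superadditive f ->
        exists (G : groupType) (phi : UMagmaMorphism.type H G),
          [/\ injective phi, finitely_generated G & distortion_approx phi f],
      forall (G : groupType) (phi : UMagmaMorphism.type H G),
        injective phi -> finitely_generated G -> solvable_group G ->
        exists f : nat -> nat,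
          [/\ maps_to_N f, increasing f, superadditive f & distortion_approx phi f]
    & forall f : nat -> nat, maps_to_N f -> increasing f -> superadditive f ->
        exists (G : groupType) (phi : UMagmaMorphism.type H G),
          [/\ injective phi, finitely_generated G, solvable_group G
            & distortion_approx phi f]].
Proof.
split=> [G phi phiI Gfg|f fN fI fS|G phi phiI Gfg _|f fN fI fS].
- exact: distortion_superadditive.
- have [G [phi [phiI Gfg _ D]]] := realize_distortion Hcyc fN fI fS.
  by exists G, phi.
- exact: distortion_superadditive.
- exact: realize_distortion.
Qed.
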